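(* Let $f(z)=z^k-c\in\mathbb{R}[z]$ for some integer $k\ge2$ and $c\in\mathbb{R}^\times$. Let $a\in\mathbb{R}$, and let $K_\infty\subseteq\mathbb{C}$ be the field generated over $\mathbb{R}$ by all complex solutions of $f^n(z)=a$ for all $n\ge1$. (a) If $k>2$, then $K_\infty=\mathbb{C}$. (b) If $k=2$ and $c<2$, then $K_\infty=\mathbb{C}$. (c) If $k=2$ and $c\ge2$, then $K_\infty$ is $\mathbb{R}$ or $\mathbb{C}$ according to whether $a\in[-c,c^2-c]$ or not, respectively.
   Context: $f^n$ denotes the $n$-th iterate $f\circ\cdots\circ f$. *)

(* Defs.v *)
From mathcomp Require Import all_boot all_order all_algebra.
From mathcomp Require Import complex.
From mathcomp Require Import classical_sets reals.

Set Implicit Arguments.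
Unset Strict Implicit.
Unset Printing Implicit Defensive.

Import Order.TTheory GRing.Theory Num.Theory.

Local Open Scope classical_set_scope.
Local Open Scope ring_scope.

(* In a field, closure under (x, y) |-> x / y includes the harmless case
   y = 0, since x / 0 = 0. *)
Definition is_subfield (F : fieldType) (A : set F) : Prop :=
  GRing.divring_closed [in A].

Definition iterated_solutions (R : realType) (f : {poly R}) (a : R) :
    set R[i] :=
  [set z | exists2 n : nat, (1 <= n)%N &
     iter n (horner (map_poly (real_complex R) f)) z = real_complex R a].

Definition Kinfty (R : realType) (f : {poly R}) (a : R) : set R[i] :=
  smallest (@is_subfield R[i])
    (range (real_complex R) `|` iterated_solutions f a).

(* Main.v *)
Require Import Defs.
From mathcomp Require Import all_boot all_order all_algebra.
From mathcomp Require Import complex.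
From mathcomp Require Import classical_sets reals.
From mathcomp Require Import boolp.
From mathcomp Require Import lra.

Set Implicit Arguments.
Unset Strict Implicit.
Unset Printing Implicit Defensive.

Import Order.TTheory GRing.Theory Num.Theory.

Local Open Scope classical_set_scope.
Local Open Scope ring_scope.

(** There is no field strictly between the reals and the complex numbers, so
    [Kinfty f a] is one of the two, and it is the field of reals exactly when
    the whole backward orbit of [a] is real ([Kinfty_real],
    [Kinfty_nonreal]).  The theorem thus asks for which [a] all iterated
    preimages of [a] under [z ^+ k - c] are real.

    For [k > 2] this never happens: a nonzero real number always has a nonreal
    [k]-th root ([nonreal_root]), so the fibre of [a] contains a nonreal
    point, unless [a = - c]; in that case the fibre is [0], whose own fibre
    consists of the [k]-th roots of [c != 0].

    For [k = 2], let [S] be the set of reals all of whose iterated preimages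
    are real.  If [x] is in [S], then [x + c >= 0] and both square roots of
    [x + c] are in [S]; applying the inequality to the negative one gives
    [S `<=` [- c, c ^+ 2 - c]] ([preimages_real_bounds]).  If [c >= 2], the
    interval is closed under taking preimages, because it then contains
    [[- c, c]]; hence it equals [S].  If [c < 2], then [S] is empty: otherwise
    [- c <= - sqrt (x + c) <= 0] for some [x], so that [c > 0], and the
    supremum [s] of [S] satisfies [s <= c ^+ 2 - c < c < 2], while
    [sqrt (x + c) <= s] for all [x] in [S] gives [s + c <= s ^+ 2], hence
    [2 * s < s ^+ 2]; as [s >= 0], this forces [s > 2]. *)

(** * Fields between the real and the complex numbers *)

(** The case [n = 0], which [iterated_solutions] leaves out, only adds the real
    point [b] itself; including it makes the predicate pass from [b] to its
    preimages and lets inductions start at [0]. *)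
Definition preimages_real (R : realType) (f : {poly R}) (b : R) : Prop :=
  forall n (z : R[i]),
    iter n (horner (map_poly (real_complex R) f)) z = real_complex R b ->
    z \is Num.real.

Lemma range_real_complexP (R : realType) (z : R[i]) :
  range (real_complex R) z <-> z \is Num.real.
Proof.
split=> [[x _ <-]|/complex_realP[x ->]]; last by exists x.
by apply/complex_realP; exists x.
Qed.

Lemma is_subfield_real (R : realType) : is_subfield (range (real_complex R)).
Proof.
split=> [|x y|x y]; rewrite !inE; first by exists 1; rewrite // rmorph1.
  by move=> [u _ <-] [v _ <-]; exists (u - v); rewrite // rmorphB.
by move=> [u _ <-] [v _ <-]; exists (u / v); rewrite // fmorph_div.
Qed.

(** A nonreal [z] gives ['i] as [(z - Re z) / Im z], and then every complex
    number. *)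
Lemma subfield_nonreal_setT (R : realType) (A : set R[i]) (z : R[i]) :
  is_subfield A -> range (real_complex R) `<=` A -> A z ->
  z \isn't Num.real -> A = setT.
Proof.
move=> fldA realA Az; case: z Az => u v Az; rewrite complex_real => v0.
have [_ subA divA] := fldA.
have sub x y : A x -> A y -> A (x - y).
  by move=> Ax Ay; apply/set_mem/subA; apply/mem_set.
have div x y : A x -> A y -> A (x / y).
  by move=> Ax Ay; apply/set_mem/divA; apply/mem_set.
have re x : A (real_complex R x) by apply: realA; exists x.
have vC0 : real_complex R v != 0 by rewrite fmorph_eq0.
have Ai : A 'i%C.
  have -> : 'i%C = ((u +i* v)%C - real_complex R u) / real_complex R v.
    rewrite [X in X - _]complexE /= addrC addKr.
    by rewrite mulfK.
  by apply: div => //; apply: sub.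
apply/seteqP; split=> // w _; rewrite (complexE w) -[X in _ + X]opprK.
apply: (sub) => //; rewrite -[X in A X]sub0r; apply: (sub); first exact: (re 0).
have [->|Imw0] := eqVneq (complex.Im w) 0; first by rewrite mulr0; exact: (re 0).
rewrite -[real_complex R (complex.Im w)]invrK.
by apply: div => //; rewrite -fmorphV; exact: re.
Qed.

Lemma Kinfty_real (R : realType) (f : {poly R}) (a : R) :
  preimages_real f a -> Kinfty f a = range (real_complex R).
Proof.
move=> reala; apply/seteqP; split.
  apply: smallest_sub; first exact: is_subfield_real.
  by move=> z [//|[n _ /reala zR]]; apply/range_real_complexP.
by apply: sub_smallest => z; left.
Qed.

Lemma Kinfty_nonreal (R : realType) (f : {poly R}) (a : R) :
  ~ preimages_real f a -> Kinfty f a = setT.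
Proof.
move=> /existsNP[n /existsNP[z /not_implyP[fz /negP zNR]]].
apply/seteqP; split=> // w _ A [fldA sA].
suff -> : A = setT by [].
apply: (@subfield_nonreal_setT _ _ z) => //.
  by move=> t tR; apply: sA; left.
apply: sA; right; exists n => //; case: n fz => //= za.
by case/negP: zNR; apply/complex_realP; exists a.
Qed.

(** * Backward orbits of [z ^+ k - c] *)

Lemma horner_map_XnsubC (R : realType) (k : nat) (c : R) (z : R[i]) :
  (map_poly (real_complex R) ('X^k - c%:P)).[z] = z ^+ k - real_complex R c.
Proof. by rewrite rmorphB /= map_polyXn map_polyC !hornerE. Qed.

Lemma preimages_real_fiber (R : realType) (k : nat) (c b : R) (w : R[i]) :
  preimages_real ('X^k - c%:P) b -> w ^+ k = real_complex R (b + c) ->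
  w \is Num.real.
Proof.
move=> realb wk; apply: (realb 1) => /=.
by rewrite horner_map_XnsubC wk rmorphD addrK.
Qed.

Lemma preimages_real_pred (R : realType) (k : nat) (c b y : R) :
  preimages_real ('X^k - c%:P) b -> y ^+ k = b + c ->
  preimages_real ('X^k - c%:P) y.
Proof.
move=> realb yk n z fz; apply: (realb n.+1); rewrite iterS fz.
by rewrite horner_map_XnsubC -rmorphXn yk rmorphD addrK.
Qed.

(** The principal root [k.-root b] is never negative, and it is nonnegative
    only if [b] is; so it is not real for [b < 0]. *)
Lemma nonreal_root_neg (R : realType) (k : nat) (b : R) :
  (1 < k)%N -> b < 0 ->
  exists2 w : R[i], w ^+ k = real_complex R b & w \isn't Num.real.
Proof.
move=> k1 b0; have k0 := ltnW k1.
exists (k.-root (real_complex R b)); first exact: rootCK.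
by rewrite realE rootC_ge0 // rootC_le0 // fmorph_eq0 lt_eqF // orbF
  -[X in X <= _](rmorph0 (real_complex R)) lecR leNgt b0.
Qed.

Lemma nonreal_root (R : realType) (k : nat) (b : R) :
  (2 < k)%N -> b != 0 ->
  exists2 w : R[i], w ^+ k = real_complex R b & w \isn't Num.real.
Proof.
move=> k2; rewrite neq_lt => /orP[b0|b0].
  exact: nonreal_root_neg (ltnW k2) b0.
have [k_odd|k_even] := boolP (odd k).
  have [|w wk wNR] := @nonreal_root_neg R k (- b) (ltnW k2); first lra.
  exists (- w); last by rewrite realN.
  by rewrite exprNn wk -signr_odd k_odd rmorphN /= mulrNN mul1r.
(* As [k > 2] is even, [k./2 > 1]: a [k./2]-th root of the negative square
   root of [b] will do. *)
have kE : k = (k./2 * 2)%N by rewrite muln2 even_halfK.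
have [||w wk wNR] := @nonreal_root_neg R k./2 (- Num.sqrt b).
- by move: k2; rewrite kE; case: (k./2) => [|[]].
- by rewrite oppr_lt0 sqrtr_gt0.
exists w => //; rewrite kE exprM wk -rmorphXn sqrrN sqr_sqrtr //.
exact: ltW.
Qed.

Lemma not_preimages_real_gt2 (R : realType) (k : nat) (c a : R) :
  (2 < k)%N -> c != 0 -> ~ preimages_real ('X^k - c%:P) a.
Proof.
move=> k2 c0 reala.
have nz b : preimages_real ('X^k - c%:P) b -> b + c = 0.
  move=> realb; apply/eqP/negP => /negP bc0.
  have [w wk] := nonreal_root k2 bc0.
  by rewrite (preimages_real_fiber realb wk).
have real0 : preimages_real ('X^k - c%:P) 0.
  apply: (preimages_real_pred reala).
  by rewrite (nz _ reala) expr0n gtn_eqF // (ltn_trans _ k2).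
by move: (nz _ real0); rewrite add0r; apply/eqP.
Qed.

(** * The quadratic case *)

Lemma preimages_real_ge (R : realType) (c b : R) :
  preimages_real ('X^2 - c%:P) b -> - c <= b.
Proof.
move=> realb; rewrite -subr_ge0 opprK leNgt; apply/negP => bc0.
have [//|w wk] := @nonreal_root_neg R 2 _ _ bc0.
by rewrite (preimages_real_fiber realb wk).
Qed.

Lemma preimages_real_sqrt (R : realType) (c b : R) :
  preimages_real ('X^2 - c%:P) b ->
  preimages_real ('X^2 - c%:P) (Num.sqrt (b + c)).
Proof.
move=> realb; apply: (preimages_real_pred realb); rewrite sqr_sqrtr //.
by have := preimages_real_ge realb; lra.
Qed.

(** The lower bound at the preimage [- sqrt (b + c)] is what bounds [b] from
    above. *)
Lemma preimages_real_bounds (R : realType) (c b : R) :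
  preimages_real ('X^2 - c%:P) b -> b \in `[- c, c ^+ 2 - c].
Proof.
move=> realb; have b_ge := preimages_real_ge realb.
have sqr : Num.sqrt (b + c) ^+ 2 = b + c by rewrite sqr_sqrtr //; lra.
have realN : preimages_real ('X^2 - c%:P) (- Num.sqrt (b + c)).
  by apply: (preimages_real_pred realb); rewrite sqrrN.
have := preimages_real_ge realN; rewrite lerN2 => s_le_c.
by rewrite in_itv /= b_ge /= lerBrDr -sqr lerXn2r // nnegrE ?sqrtr_ge0
  ?(le_trans _ s_le_c) ?sqrtr_ge0.
Qed.

Lemma not_preimages_real_lt2 (R : realType) (c a : R) :
  c != 0 -> c < 2 -> ~ preimages_real ('X^2 - c%:P) a.
Proof.
move=> c0 c2 reala.
pose S : set R := [set x | preimages_real ('X^2 - c%:P) x].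
have ubS : ubound S (c ^+ 2 - c).
  by move=> x /preimages_real_bounds; rewrite in_itv => /andP[].
have supS : has_ubound S by exists (c ^+ 2 - c).
have Sa : S !=set0 by exists a.
have s_le : sup S <= c ^+ 2 - c by apply: ge_sup.
have sqrt_le x : S x -> Num.sqrt (x + c) <= sup S.
  by move=> /preimages_real_sqrt Sx; apply: ub_le_sup.
have s_ge0 : 0 <= sup S by apply: le_trans (sqrtr_ge0 _) (sqrt_le _ reala).
have s_sqr : sup S <= sup S ^+ 2 - c.
  apply: ge_sup => // x Sx; rewrite lerBrDr -[x + c]sqr_sqrtr.
    by rewrite lerXn2r ?nnegrE ?sqrtr_ge0 ?sqrt_le.
  by have := preimages_real_ge Sx; lra.
(* The lower bound [- c] applies to the preimage [- sqrt (a + c) <= 0]. *)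
have c_gt0 : 0 < c.
  rewrite lt_neqAle eq_sym c0 /=.
  have realN : preimages_real ('X^2 - c%:P) (- Num.sqrt (a + c)).
    apply: (preimages_real_pred reala); rewrite sqrrN sqr_sqrtr //.
    by have := preimages_real_ge reala; lra.
  by have := preimages_real_ge realN; have := sqrtr_ge0 (a + c); lra.
have s_lt_c : sup S < c by nra.
(* [2 * sup S < sup S + c <= sup S ^+ 2], whereas [0 <= sup S < 2]. *)
nra.
Qed.

(** For [b] in the interval, [b + c] is in [[0, c ^+ 2]], so its square roots
    are real and in [[- c, c]]; and [c <= c ^+ 2 - c] because [c >= 2]. *)
Lemma preimages_real_itv (R : realType) (c b : R) :
  2 <= c -> b \in `[- c, c ^+ 2 - c] -> preimages_real ('X^2 - c%:P) b.
Proof.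
move=> c2 b_itv n; elim: n b b_itv => [|n IHn] b b_itv z.
  by move=> /= ->; apply/complex_realP; exists b.
rewrite iterS horner_map_XnsubC => /eqP; rewrite subr_eq -rmorphD.
move: b_itv; rewrite in_itv /= => /andP[b_ge b_le].
have s_ge0 := sqrtr_ge0 (b + c).
have sqr : Num.sqrt (b + c) ^+ 2 = b + c by rewrite sqr_sqrtr //; lra.
have s_le : Num.sqrt (b + c) <= c.
  rewrite -(@ler_pXn2r _ 2) ?nnegrE // ?sqr; lra.
rewrite -sqr rmorphXn /= eqf_sqr -(rmorphN (real_complex R)).
by move=> /orP[] /eqP ws; apply: (IHn _ _ _ ws); rewrite in_itv /=; nra.
Qed.

Theorem theorem8p1 (R : realType) (k : nat) (c a : R)
    (hk : (2 <= k)%N) (hc : c != 0) :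
  let f : {poly R} := 'X^k - c%:P in
  [/\ (2 < k)%N -> Kinfty f a = setT,
      k = 2%N -> c < 2 -> Kinfty f a = setT
    & k = 2%N -> 2 <= c ->
        (a \in `[- c, c ^+ 2 - c] -> Kinfty f a = range (real_complex R)) /\
        (a \notin `[- c, c ^+ 2 - c] -> Kinfty f a = setT)].
Proof.
move=> f; split=> [k2|k2 c2|k2 c2]; rewrite /f ?k2.
- exact/Kinfty_nonreal/not_preimages_real_gt2.
- exact/Kinfty_nonreal/not_preimages_real_lt2.
split=> [a_itv|/negP aN]; first exact/Kinfty_real/preimages_real_itv.
by apply: Kinfty_nonreal => /preimages_real_bounds.
Qed.
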